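(* Let $R_1$ and $R_2$ be commutative rings with nonzero identity, let $R=R_1\times R_2$, let $I_1$ and $I_2$ be ideals of $R_1$ and $R_2$ respectively, and let $I=I_1\times I_2$. Let $M_1$ and $M_2$ be unitary modules over $R_1$ and $R_2$ respectively, and let $M=M_1\times M_2$, regarded as an $R$-module componentwise. Suppose that $P_1$ is an $I_1$-primary submodule of $M_1$ such that $I_1P_1\times M_2\subseteq I(P_1\times M_2)$. Then $P_1\times M_2$ is an $I$-primary submodule of $M_1\times M_2$.
   Context: For a commutative ring $A$, an ideal $J$ of $A$ and an $A$-module $X$, a proper submodule $Q$ of $X$ is called a $J$-primary submodule of $X$ if for all $a\in A$ and $x\in X$, $ax\in Q\setminus JQ$ implies $x\in Q$ or $a\in\sqrt{(Q:X)}$, where $(Q:X)=\{a\in A : aX\subseteq Q\}$ and $\sqrt{B}=\{a\in A : a^n\in B\text{ for some positive integer }n\}$ for an ideal $B$ of $A$. *)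

(* Defs.v *)
From HB Require Import structures.
From mathcomp Require Import all_boot all_algebra.
From mathcomp Require Import boolp classical_sets.

Set Implicit Arguments.
Unset Strict Implicit.
Unset Printing Implicit Defensive.

Import GRing.Theory.
Local Open Scope classical_set_scope.
Local Open Scope ring_scope.

Section Submodules.
Variables (A : comPzRingType) (X : lmodType A).
Implicit Types (J : set A) (Q : set X).

Definition submodule Q : Prop := GRing.submod_closed [in Q].

(* The ideals of A are the submodules of the regular module A^o; MathComp's
   idealr_closed is not usable here since it only covers proper ideals. *)
Definition ideal J : Prop := @GRing.submod_closed A A^o [in J].

Definition ideal_mul J Q : set X :=
  [set x | exists n (a : 'I_n -> A) (q : 'I_n -> X),
     [/\ forall i, J (a i), forall i, Q (q i)
       & x = \sum_(i < n) a i *: q i]].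

Definition colon Q : set A := [set a | forall x, Q (a *: x)].

Definition radical J : set A := [set a | exists2 n, (0 < n)%N & J (a ^+ n)].

Definition primary_submodule J Q : Prop :=
  [/\ submodule Q, Q <> setT
    & forall (a : A) (x : X), (Q `\` ideal_mul J Q) (a *: x) ->
        Q x \/ radical (colon Q) a].

End Submodules.

(* The product of modules over two different rings, as a module over the
   product ring.  The alias keeps this structure apart from MathComp's own
   scaling on M1 * M2, which needs M1 and M2 to share their ring of scalars. *)
Definition prod_module (R1 R2 : pzRingType) (M1 : lmodType R1)
  (M2 : lmodType R2) : Type := (M1 * M2)%type.

Section ProdModule.
Variables (R1 R2 : pzRingType) (M1 : lmodType R1) (M2 : lmodType R2).

HB.instance Definition _ :=
  GRing.Zmodule.copy (prod_module M1 M2) (M1 * M2)%type.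

Definition prod_scale (r : R1 * R2) (m : prod_module M1 M2) :
  prod_module M1 M2 := (r.1 *: m.1, r.2 *: m.2).

Fact prod_scaleA r s m :
  prod_scale r (prod_scale s m) = prod_scale (r * s) m.
Proof. by rewrite /prod_scale !scalerA. Qed.

Fact prod_scale1 : left_id 1 prod_scale.
Proof. by case=> x y; rewrite /prod_scale !scale1r. Qed.

Fact prod_scaleDr : right_distributive prod_scale +%R.
Proof. by move=> r m n; rewrite /prod_scale !scalerDr. Qed.

Fact prod_scaleDl m : {morph prod_scale^~ m : r s / r + s}.
Proof. by move=> r s; rewrite /prod_scale !scalerDl. Qed.

HB.instance Definition _ :=
  GRing.Zmodule_isLmodule.Build (R1 * R2)%type (prod_module M1 M2)
    prod_scaleA prod_scale1 prod_scaleDr prod_scaleDl.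

Definition prod_set (Q1 : set M1) (Q2 : set M2) : set (prod_module M1 M2) :=
  Q1 `*` Q2.

End ProdModule.

(* Main.v *)
Require Import Defs.
From HB Require Import structures.
From mathcomp Require Import all_boot all_algebra.
From mathcomp Require Import boolp classical_sets.

Set Implicit Arguments.
Unset Strict Implicit.
Unset Printing Implicit Defensive.

Import GRing.Theory.
Local Open Scope classical_set_scope.
Local Open Scope ring_scope.

(** Membership in [P1 * M2] depends on the first coordinate alone, so each condition reduces to the
    one for [P1]. The only delicate point is the excluded set: the inclusion [subI], read
    contrapositively, turns [r *: m] outside [I (P1 * M2)] into [r.1 *: m.1] outside [I1 P1], where
    primariness of [P1] applies. *)

Lemma submoduleP (A : comPzRingType) (X : lmodType A) (Q : set X) :
  submodule Q <->
  Q 0 /\ forall (a : A) (u v : X), Q u -> Q v -> Q (a *: u + v).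
Proof.
split=> [[Q0 Qlin]|[Q0 Qlin]]; split.
- exact: set_mem Q0.
- by move=> a u v Qu Qv; apply/set_mem/Qlin; apply: mem_set.
- exact: mem_set Q0.
- by move=> a u v /set_mem Qu /set_mem Qv; apply/mem_set/Qlin.
Qed.

Theorem theorem2p8 (R1 R2 : comNzRingType) (I1 : set R1) (I2 : set R2)
    (M1 : lmodType R1) (M2 : lmodType R2) (P1 : set M1) :
  ideal I1 -> ideal I2 ->
  primary_submodule I1 P1 ->
  prod_set (ideal_mul I1 P1) [set: M2] `<=`
    ideal_mul (I1 `*` I2) (prod_set P1 [set: M2]) ->
  primary_submodule (I1 `*` I2) (prod_set P1 [set: M2]).
Proof.
move=> _ _ [/submoduleP [P10 P1lin] P1proper P1primary] subI; split.
- apply/submoduleP; split=> [|r u v [Pu _] [Pv _]]; split=> //.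
  exact: P1lin.
- move=> PT; apply: P1proper; apply/seteqP; split=> // x _.
  (* Any second coordinate would do; [0] is one that always exists. *)
  suff: prod_set P1 [set: M2] (x, 0) by case.
  by rewrite PT.
- move=> r m [[/= Prm _] nIrm].
  have [|Pm|[n n_gt0 Prn]] := P1primary r.1 m.1.
  (* If [r.1 *: m.1] were in [I1 P1], then [r *: m] would be in [I1 P1 * M2], hence in
     [I (P1 * M2)], against [nIrm]. *)
  + by split=> // Irm; apply: nIrm; apply: subI.
  + by left.
  + right; exists n => // x; split=> //=.
    (* The first projection is a ring morphism, so [(r ^+ n).1] is [r.1 ^+ n] and the same exponent
       serves. *)
    by rewrite (rmorphXn (@fst R1 R2)); apply: Prn.
Qed.
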